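(* Let $f(x,t):=\sum_{n=0}^\infty \frac{x^n(e^{-t})^n}{n!\,n!}$. Then for every $x\in\mathbb{C}$, $$\sum_{n=0}^\infty \frac{\sqrt n}{n!}\,\frac{x^n}{n!}=-\frac{1}{2\sqrt\pi}\int_0^\infty\left[f(x,u)-f(x,0)\right]\frac{du}{u^{3/2}}.$$ *)

(* Defs.v *)
From Stdlib Require Import Reals Factorial.
From Coquelicot Require Import Coquelicot.

Local Open Scope C_scope.

(* Coquelicot's [Series] is restricted to real terms.  Outside the convergent
   case the value is unspecified, as for [RInt_gen]. *)
Definition CSeries (a : nat -> C) : C :=
  iota (fun l : C_CompleteNormedModule => is_series (V := C_NormedModule) a l).

Definition f_term (x : C) (t : R) (n : nat) : C :=
  x ^ n * RtoC (exp (- t)) ^ n / (RtoC (INR (fact n)) * RtoC (INR (fact n))).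

Definition f_fun (x : C) (t : R) : C := CSeries (f_term x t).

Definition sqrt_term (x : C) (n : nat) : C :=
  RtoC (sqrt (INR n)) / RtoC (INR (fact n)) * (x ^ n / RtoC (INR (fact n))).

Definition integrand (x : C) (u : R) : C :=
  (f_fun x u - f_fun x 0) / RtoC (Rpower u (3 / 2)).

Lemma CSeries_unique (a : nat -> C) (l : C) :
  is_series (V := C_NormedModule) a l -> CSeries a = l.
Proof.
intros H; unfold CSeries.
exact (iota_filterlim_locally (V := C_CompleteNormedModule) (sum_n a) l H).
Qed.

Lemma CSeries_correct (a : nat -> C) :
  ex_series (V := C_NormedModule) a ->
  is_series (V := C_NormedModule) a (CSeries a).
Proof.
intros [l Hl]; rewrite (CSeries_unique a l Hl); exact Hl.
Qed.

(* Main.v *)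
Require Import Defs.
From Stdlib Require Import Reals Factorial Lra Lia.
From Coquelicot Require Import Coquelicot.
Local Open Scope R_scope.

(** Write [c n] for [x ^ n / n!^2], so that [f x u - f x 0] is the series of
    [(exp (- n u) - 1) c n].  The identity is the case of this series of the
    formula that takes a square root of the operator [- d/du]: it suffices that
<<
      int_0^oo (exp (- n u) - 1) u^(-3/2) du = - 2 sqrt PI sqrt n
>>
    and that sum and integral can be exchanged.

    The substitution [w = n u] extracts the factor [sqrt n] and leaves the
    integral of [(1 - exp (- w)) w^(-3/2)].  By parts and with [w = v^2] this
    function has the primitive [half_prim], made of elementary functions and of
    the integral of [exp (- t^2)] from [0] to [sqrt w].  It tends to [0] at
    [0+] and, by the Gaussian integral ([gauss_int_lim]), to [2 sqrt PI] at
    infinity.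

    The exchange does not integrate the series over the half-line at once.  On a
    segment with positive ends the series converges uniformly and is
    integrated termwise ([is_RInt_series]), so that the integral is the
    difference of the values at the two ends of the series of primitives
    [sqrt n * half_prim (n u)] times [c n].  Since [half_prim] is bounded, that
    series is dominated, uniformly in [u], by a multiple of [sqrt n |c n|], and
    its limits at [0+] and at infinity can be taken term by term ([tannery]).
    Only the summability of [sqrt n |c n|] is used, in any complete normed
    space: see [half_derivative_exp_series]. *)

(** * The Gaussian integral *)

Lemma exp_le_1 (y : R) : y <= 0 -> exp y <= 1.
Proof.
intros [Hy| ->]; rewrite <- exp_0; [left; apply exp_increasing; auto | right; auto].
Qed.

Definition gauss_int (v : R) : R := RInt (fun t => exp (- t ^ 2)) 0 v.

Lemma ex_RInt_gauss (a b : R) : ex_RInt (fun t => exp (- t ^ 2)) a b.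
Proof.
apply (ex_RInt_continuous (V := R_CompleteNormedModule)); intros t _.
apply (ex_derive_continuous (V := R_NormedModule)); auto_derive; auto.
Qed.

Lemma is_derive_gauss_int (v : R) : is_derive gauss_int v (exp (- v ^ 2)).
Proof.
apply (is_derive_RInt (V := R_NormedModule) (fun t => exp (- t ^ 2)) _ 0).
- apply filter_forall; intros b.
  apply (RInt_correct (V := R_CompleteNormedModule)), ex_RInt_gauss.
- apply (ex_derive_continuous (V := R_NormedModule)); auto_derive; auto.
Qed.

Lemma gauss_int_0 : gauss_int 0 = 0.
Proof. exact (RInt_point (V := R_CompleteNormedModule) 0 _). Qed.

Lemma gauss_int_ge0 (v : R) : 0 <= v -> 0 <= gauss_int v.
Proof.
intros Hv; apply RInt_ge_0; auto using ex_RInt_gauss.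
intros t _; left; apply exp_pos.
Qed.

Lemma gauss_int_le_id (v : R) : 0 <= v -> gauss_int v <= v.
Proof.
intros Hv.
replace v with (RInt (fun _ => 1) 0 v) at 2.
2: { rewrite RInt_const; unfold scal; simpl; unfold mult; simpl; ring. }
apply RInt_le; auto using ex_RInt_gauss.
- exact (ex_RInt_const (V := R_NormedModule) 0 v 1).
- intros t _; apply exp_le_1; pose proof (pow2_ge_0 t); lra.
Qed.

(** The complement of the square of [gauss_int] to [PI / 4]: the derivatives are
    opposite, and at [0] this is the integral of the derivative of [atan].  It
    takes the place of the double integral in polar coordinates, and at
    infinity it is at most [exp (- v ^ 2)]. *)
Definition gauss_defect (v : R) : R :=
  RInt (fun t => exp (- (v ^ 2 * (1 + t ^ 2))) / (1 + t ^ 2)) 0 1.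

Lemma one_plus_sqr_pos (t : R) : 0 < 1 + t ^ 2.
Proof. pose proof (pow2_ge_0 t); lra. Qed.

Lemma ex_RInt_gauss_defect (v a b : R) :
  ex_RInt (fun t => exp (- (v ^ 2 * (1 + t ^ 2))) / (1 + t ^ 2)) a b.
Proof.
apply (ex_RInt_continuous (V := R_CompleteNormedModule)); intros t _.
apply (ex_derive_continuous (V := R_NormedModule)); auto_derive.
pose proof (one_plus_sqr_pos t); lra.
Qed.

(** Differentiating under the integral cancels the denominator [1 + t^2]; what
    is left is a Gaussian in [v t], and rescaling [t] gives [gauss_int v]. *)
Lemma is_derive_gauss_defect (v : R) :
  is_derive gauss_defect v (- 2 * exp (- v ^ 2) * gauss_int v).
Proof.
assert (D : forall u t, is_derive
  (fun z : R => exp (- (z ^ 2 * (1 + t ^ 2))) / (1 + t ^ 2)) u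
  (- 2 * u * exp (- (u ^ 2 * (1 + t ^ 2))))).
{ intros u t; pose proof (one_plus_sqr_pos t).
  auto_derive; [lra|].
  replace (u * (u * 1)) with (u ^ 2) by ring.
  replace (t * (t * 1)) with (t ^ 2) by ring.
  field; lra. }
replace (- 2 * exp (- v ^ 2) * gauss_int v) with
  (RInt (fun t => Derive
     (fun z => exp (- (z ^ 2 * (1 + t ^ 2))) / (1 + t ^ 2)) v) 0 1).
- apply (is_derive_RInt_param
    (fun z t => exp (- (z ^ 2 * (1 + t ^ 2))) / (1 + t ^ 2))).
  + apply filter_forall; intros u t _; eexists; apply D.
  + intros t _.
    apply (continuity_2d_pt_ext
      (fun u t => - 2 * u * exp (- (u ^ 2 * (1 + t ^ 2))))).
    { intros u s; symmetry; apply is_derive_unique, D. }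
    apply continuity_2d_pt_filterlim.
    apply (continuous_mult (K := R_AbsRing)
             (fun z : R * R => -2 * fst z)
             (fun z : R * R => exp (- (fst z ^ 2 * (1 + snd z ^ 2))))).
    * apply (continuous_mult (K := R_AbsRing) (fun _ : R * R => -2)).
      apply continuous_const. apply continuous_fst.
    * apply (continuous_comp (fun z : R * R => - (fst z ^ 2 * (1 + snd z ^ 2)))
               exp).
      2: apply continuous_exp.
      apply (continuous_opp (V := R_NormedModule)).
      apply (continuous_mult (K := R_AbsRing)
               (fun z : R * R => fst z ^ 2) (fun z : R * R => 1 + snd z ^ 2)).
      -- apply (continuous_comp (fun z : R * R => fst z) (fun y => y ^ 2)).
         apply continuous_fst.
         apply (ex_derive_continuous (V := R_NormedModule)); auto_derive; auto.
      -- apply (continuous_comp (fun z : R * R => snd z) (fun y => 1 + y ^ 2)).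
         apply continuous_snd.
         apply (ex_derive_continuous (V := R_NormedModule)); auto_derive; auto.
  + apply filter_forall; intros u; apply ex_RInt_gauss_defect.
- rewrite (RInt_ext (V := R_CompleteNormedModule) _
    (fun t => scal (- 2 * exp (- v ^ 2)) (scal v (exp (- (v * t + 0) ^ 2))))).
  + rewrite (RInt_scal (V := R_CompleteNormedModule)).
    2: { apply (ex_RInt_comp_lin (V := R_NormedModule) (fun y => exp (- y ^ 2))).
         apply ex_RInt_gauss. }
    rewrite (RInt_comp_lin (V := R_CompleteNormedModule) (fun y => exp (- y ^ 2))).
    2: apply ex_RInt_gauss.
    unfold scal; simpl; unfold mult; simpl; unfold gauss_int.
    f_equal; f_equal; ring.
  + intros t _; rewrite (is_derive_unique _ _ _ (D v t)).
    unfold scal; simpl; unfold mult; simpl.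
    replace (- (v * (v * 1) * (1 + t * (t * 1)))) with
      (- (v * (v * 1)) + - ((v * t + 0) * ((v * t + 0) * 1))) by ring.
    rewrite exp_plus; ring.
Qed.

Lemma gauss_defect_0 : gauss_defect 0 = PI / 4.
Proof.
unfold gauss_defect.
replace (PI / 4) with (minus (atan 1) (atan 0)).
2: { rewrite atan_1, atan_0; unfold minus, plus, opp; simpl; ring. }
apply is_RInt_unique.
apply (is_RInt_derive (V := R_CompleteNormedModule) atan).
- intros t _; pose proof (one_plus_sqr_pos t).
  replace (exp (- (0 ^ 2 * (1 + t ^ 2))) / (1 + t ^ 2)) with (/ (1 + t ^ 2)).
  2: { replace (- (0 ^ 2 * (1 + t ^ 2))) with 0 by ring.
       rewrite exp_0; field; lra. }
  replace (t ^ 2) with (Rsqr t) by (unfold Rsqr; ring).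
  apply is_derive_atan.
- intros t _; apply (ex_derive_continuous (V := R_NormedModule)); auto_derive.
  pose proof (one_plus_sqr_pos t); lra.
Qed.

Lemma gauss_int_sqr (v : R) :
  0 <= v -> gauss_int v ^ 2 = PI / 4 - gauss_defect v.
Proof.
intros [Hv|<-].
2: rewrite gauss_int_0, gauss_defect_0; ring.
assert (E : gauss_int 0 ^ 2 + gauss_defect 0 = gauss_int v ^ 2 + gauss_defect v).
{ apply (eq_is_derive (V := R_NormedModule)
    (fun w => gauss_int w ^ 2 + gauss_defect w)); auto.
  intros w _.
  replace (@zero R_NormedModule) with
    (INR 2 * exp (- w ^ 2) * gauss_int w ^ 1 + - 2 * exp (- w ^ 2) * gauss_int w).
  2: { simpl; unfold zero; simpl; ring. }
  apply (is_derive_plus (V := R_NormedModule)).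
  - apply (is_derive_pow gauss_int 2), is_derive_gauss_int.
  - apply is_derive_gauss_defect. }
rewrite gauss_int_0, gauss_defect_0 in E; lra.
Qed.

Lemma gauss_defect_bounds (v : R) : 0 <= gauss_defect v <= exp (- v ^ 2).
Proof.
split.
- apply RInt_ge_0; auto using ex_RInt_gauss_defect; try lra.
  intros t _; apply Rlt_le, Rdiv_lt_0_compat;
    auto using exp_pos, one_plus_sqr_pos.
- replace (exp (- v ^ 2)) with (RInt (fun _ => exp (- v ^ 2)) 0 1).
  2: { rewrite RInt_const; unfold scal; simpl; unfold mult; simpl; ring. }
  apply RInt_le; auto using ex_RInt_gauss_defect; try lra.
  { exact (ex_RInt_const (V := R_NormedModule) 0 1 _). }
  intros t _; pose proof (one_plus_sqr_pos t); pose proof (pow2_ge_0 t).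
  apply Rle_div_l; auto.
  apply Rle_trans with (exp (- v ^ 2) * 1).
  + replace (- (v ^ 2 * (1 + t ^ 2))) with (- v ^ 2 + - (v * t) ^ 2) by ring.
    rewrite exp_plus; apply Rmult_le_compat_l; [left; apply exp_pos|].
    apply exp_le_1; pose proof (pow2_ge_0 (v * t)); lra.
  + apply Rmult_le_compat_l; [left; apply exp_pos | lra].
Qed.

Lemma gauss_int_le1 (v : R) : 0 <= v -> gauss_int v <= 1.
Proof.
intros Hv; pose proof (gauss_int_sqr v Hv); pose proof (gauss_defect_bounds v).
pose proof PI_4; pose proof (gauss_int_ge0 v Hv); nra.
Qed.

Lemma gauss_int_lim :
  filterlim gauss_int (Rbar_locally p_infty) (locally (sqrt PI / 2)).
Proof.
assert (L : filterlim gauss_defect (Rbar_locally p_infty) (locally 0)).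
{ apply (is_lim_le_le_loc (fun _ => 0) (fun v => exp (- v)) gauss_defect p_infty 0).
  - exists 1; intros v Hv; split; [apply gauss_defect_bounds|].
    apply Rle_trans with (1 := proj2 (gauss_defect_bounds v)).
    left; apply exp_increasing; nra.
  - apply is_lim_const.
  - apply (is_lim_comp exp Ropp p_infty 0 m_infty).
    + apply is_lim_exp_m.
    + apply (is_lim_opp (fun y => y) p_infty p_infty), is_lim_id.
    + exists 0; intros; discriminate. }
replace (sqrt PI / 2) with (sqrt (PI / 4 - 0)).
2: { rewrite Rminus_0_r, sqrt_div_alt by lra.
     replace 4 with (2 ^ 2) by ring; rewrite sqrt_pow2 by lra; reflexivity. }
apply (filterlim_ext_loc (fun v => sqrt (PI / 4 - gauss_defect v))).
{ exists 0; intros v Hv; rewrite <- gauss_int_sqr by lra.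
  apply sqrt_pow2, gauss_int_ge0; lra. }
apply (filterlim_comp _ _ _ gauss_defect (fun y => sqrt (PI / 4 - y)) _ _ _ L).
apply (continuous_comp (fun y => PI / 4 - y) sqrt).
- apply (ex_derive_continuous (V := R_NormedModule)); auto_derive; auto.
- apply continuous_sqrt.
Qed.

(** * The integral of [(1 - exp (- w)) w^(-3/2)] over the half-line *)

(** The primitive of [(1 - exp (- w)) w^(-3/2)] obtained by integrating
    [w^(-3/2)] by parts and substituting [w = v^2].  As [sqrt] and [Rinv] are
    extended by [0], it vanishes for [w <= 0], which makes it bounded on the
    whole line. *)
Definition half_prim (w : R) : R :=
  4 * gauss_int (sqrt w) - 2 * (1 - exp (- w)) / sqrt w.

Lemma Rpower_three_halves (u : R) : 0 < u -> Rpower u (3 / 2) = u * sqrt u.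
Proof.
intros Hu; replace (3 / 2) with (1 + / 2) by lra.
rewrite Rpower_plus, Rpower_1, Rpower_sqrt by auto; reflexivity.
Qed.

Lemma is_derive_half_prim (w : R) :
  0 < w -> is_derive half_prim w ((1 - exp (- w)) / Rpower w (3 / 2)).
Proof.
intros Hw; assert (Hs := sqrt_lt_R0 w Hw).
rewrite Rpower_three_halves by auto.
assert (Hsq : sqrt w * sqrt w = w) by (apply sqrt_sqrt; lra).
evar_last.
{ apply (is_derive_minus (V := R_NormedModule)).
  - apply (is_derive_scal (fun w => gauss_int (sqrt w))).
    apply (is_derive_comp (V := R_NormedModule) gauss_int sqrt).
    + apply is_derive_gauss_int.
    + apply (is_derive_sqrt (fun w => w) w 1 (is_derive_id w) Hw).
  - auto_derive; [lra | reflexivity]. }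
unfold minus, plus, opp, scal; simpl; unfold mult; simpl.
rewrite Rmult_1_r, Hsq.
set (e := exp (- w)); set (s := sqrt w) in *.
rewrite <- Hsq; field; lra.
Qed.

Lemma one_minus_exp_bounds (w : R) :
  0 <= w -> 0 <= 1 - exp (- w) <= 1 /\ 1 - exp (- w) <= w.
Proof.
intros Hw; pose proof (exp_pos (- w)).
assert (exp (- w) <= 1) by (apply exp_le_1; lra).
pose proof (exp_ineq1_le (- w)); lra.
Qed.

Lemma half_prim_npos (w : R) : w <= 0 -> half_prim w = 0.
Proof.
intros Hw; unfold half_prim, Rdiv.
rewrite sqrt_neg_0 by auto; rewrite gauss_int_0, Rinv_0; ring.
Qed.

(** The first bound dominates the series of primitives; the second one gives the
    limit at [0].  The quotient [(1 - exp (- w)) / sqrt w] is at most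
    [1 / sqrt w] and at most [sqrt w], hence at most [1]; [gauss_int (sqrt w)] is
    at most [1] and at most [sqrt w]. *)
Lemma half_prim_bounds (w : R) : 0 < w ->
  Rabs (half_prim w) <= 6 /\ Rabs (half_prim w) <= 6 * sqrt w.
Proof.
intros Hw; assert (Hs := sqrt_lt_R0 w Hw); unfold half_prim.
assert (Hsq : sqrt w * sqrt w = w) by (apply sqrt_sqrt; lra).
assert (B := one_minus_exp_bounds w (Rlt_le _ _ Hw)).
assert (G0 := gauss_int_ge0 (sqrt w) (sqrt_pos w)).
assert (G1 := gauss_int_le1 (sqrt w) (sqrt_pos w)).
assert (G2 := gauss_int_le_id (sqrt w) (sqrt_pos w)).
set (q := 2 * (1 - exp (- w)) / sqrt w).
assert (Q : q * sqrt w = 2 * (1 - exp (- w))) by (unfold q; field; lra).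
split; apply Rabs_le; nra.
Qed.

Lemma half_prim_lim0 : filterlim half_prim (at_right 0) (locally 0).
Proof.
apply (filterlim_locally (F := at_right 0)); intros eps.
assert (Hd : 0 < (eps / 6) ^ 2).
{ apply pow_lt; destruct eps as [e He]; simpl; lra. }
exists (mkposreal _ Hd); intros w Hw Hpos.
unfold ball in *; simpl in *; unfold AbsRing_ball, abs, minus, plus, opp in *.
simpl in *.
rewrite Ropp_0, Rplus_0_r in *; rewrite Rabs_pos_eq in Hw by lra.
apply Rle_lt_trans with (1 := proj2 (half_prim_bounds w Hpos)).
assert (He := cond_pos eps).
apply Rlt_le_trans with (6 * (eps / 6)); [|lra].
apply Rmult_lt_compat_l; [lra|].
rewrite <- (sqrt_pow2 (eps / 6)) by lra.
apply sqrt_lt_1; simpl; nra.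
Qed.

Lemma half_prim_lim :
  filterlim half_prim (Rbar_locally p_infty) (locally (2 * sqrt PI)).
Proof.
replace (2 * sqrt PI) with (4 * (sqrt PI / 2) - 0) by field.
apply (is_lim_minus' (fun w => 4 * gauss_int (sqrt w))
         (fun w => 2 * (1 - exp (- w)) / sqrt w) p_infty).
- apply (is_lim_scal_l _ 4 p_infty (sqrt PI / 2)).
  apply (filterlim_comp _ _ _ sqrt gauss_int _ (Rbar_locally p_infty)).
  + exact filterlim_sqrt_p.
  + exact gauss_int_lim.
- apply (is_lim_le_le_loc (fun _ => 0) (fun w => 2 * / sqrt w)).
  + exists 0; intros w Hw; assert (Hs := sqrt_lt_R0 w Hw).
    assert (B := one_minus_exp_bounds w (Rlt_le _ _ Hw)).
    assert (Hi := Rinv_0_lt_compat _ Hs).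
    unfold Rdiv; nra.
  + apply is_lim_const.
  + replace (Finite 0) with (Rbar_mult 2 (Rbar_inv p_infty))
      by (simpl; f_equal; ring).
    apply is_lim_scal_l.
    apply is_lim_inv; [exact filterlim_sqrt_p | discriminate].
Qed.

(** * Exchanging a series with limits and integrals *)

Lemma weierstrass_test {K : AbsRing} {V : CompleteNormedModule K} {T : Type}
  (f : nat -> T -> V) (M : nat -> R) (g : T -> V) :
  (forall n t, norm (f n t) <= M n) -> ex_series M ->
  (forall t, is_series (fun n => f n t) (g t)) ->
  filterlim (fun N t => sum_n (fun n => f n t) N) eventually
    (locally (g : fct_UniformSpace T V)).
Proof.
intros HM HMs Hg.
apply (filterlim_locally (F := eventually) (U := fct_UniformSpace T V)).
intros eps; set (e2 := pos_div_2 eps).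
destruct (Cauchy_ex_series (V := R_CompleteNormedModule) M HMs e2) as [N0 HN0].
exists N0; intros N HN t.
destruct (proj1 (filterlim_locally (F := eventually) _ _) (Hg t) e2) as [N1 HN1].
set (P := (N0 + N1 + N + 1)%nat).
replace (pos eps) with (e2 + e2) by (unfold e2; simpl; field).
apply ball_triangle with (sum_n (fun n => f n t) P).
- apply HN1; unfold P; lia.
- apply ball_sym, (norm_compat1 (V := V)).
  assert (HNP : (N <= P)%nat) by (unfold P; lia).
  refine (eq_ind _ (fun z : V => norm z < e2) _ _
    (sum_n_m_sum_n (G := V) (fun n => f n t) N P HNP)).
  apply Rle_lt_trans with (sum_n_m (fun n => norm (f n t)) (S N) P).
  { exact (norm_sum_n_m (V := V) (fun n => f n t) (S N) P). }
  apply Rle_lt_trans with (sum_n_m M (S N) P).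
  { apply sum_n_m_le; intros n; apply HM. }
  apply Rle_lt_trans with (1 := Rle_abs _).
  apply (HN0 (S N) P); unfold P; lia.
Qed.

Lemma filterlim_sum_n {K : AbsRing} {V : NormedModule K} {T : Type}
  (f : nat -> T -> V) (F : (T -> Prop) -> Prop) (FF : Filter F) (L : nat -> V)
  (N : nat) :
  (forall n, filterlim (f n) F (locally (L n))) ->
  filterlim (fun t => sum_n (fun n => f n t) N) F (locally (sum_n L N)).
Proof.
intros HL; induction N as [|N IH].
- rewrite sum_O; apply filterlim_ext with (2 := HL O).
  intros t; rewrite sum_O; reflexivity.
- rewrite sum_Sn.
  apply filterlim_ext with
    (fun t => plus (sum_n (fun n => f n t) N) (f (S N) t)).
  { intros t; rewrite sum_Sn; reflexivity. }
  exact (filterlim_comp_2 _ _ plus IH (HL (S N)) (filterlim_plus _ _)).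
Qed.

(** Dominated convergence for series: uniform convergence of the partial sums
    in [t] allows the two limits to be switched. *)
Lemma tannery {K : AbsRing} {V : CompleteNormedModule K} {T : Type}
  (f : nat -> T -> V) (M : nat -> R) (g : T -> V)
  (F : (T -> Prop) -> Prop) (FF : ProperFilter F) (L : nat -> V) :
  (forall n t, norm (f n t) <= M n) -> ex_series M ->
  (forall t, is_series (fun n => f n t) (g t)) ->
  (forall n, filterlim (f n) F (locally (L n))) ->
  exists l, is_series L l /\ filterlim g F (locally l).
Proof.
intros HM HMs Hg HL.
apply (filterlim_switch (U := V) eventually _ F FF
  (fun N t => sum_n (fun n => f n t) N) g (sum_n L)).
- exact (weierstrass_test f M g HM HMs Hg).
- intros N; exact (filterlim_sum_n (V := V) f F _ L N HL).
Qed.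

Lemma is_RInt_sum_n {V : NormedModule R_AbsRing} (f : nat -> R -> V) (I : nat -> V)
  (a b : R) (N : nat) :
  (forall n, is_RInt (f n) a b (I n)) ->
  is_RInt (fun u => sum_n (fun n => f n u) N) a b (sum_n I N).
Proof.
intros H; induction N as [|N IH].
- rewrite sum_O; apply is_RInt_ext with (2 := H O).
  intros t _; rewrite sum_O; reflexivity.
- rewrite sum_Sn.
  apply is_RInt_ext with
    (fun t => plus (sum_n (fun n => f n t) N) (f (S N) t)).
  { intros t _; rewrite sum_Sn; reflexivity. }
  apply is_RInt_plus; auto.
Qed.

(** The estimates are needed on the segment only.  Uniform convergence of
    functions means here uniform convergence on all of [R], so the argument is
    first clamped to the segment, which does not change the integrals. *)
Lemma is_RInt_series {V : CompleteNormedModule R_AbsRing} (f : nat -> R -> V)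
  (M : nat -> R) (g : R -> V) (I : nat -> V) (l : V) (a b : R) :
  (forall n u, Rmin a b <= u <= Rmax a b -> norm (f n u) <= M n) -> ex_series M ->
  (forall u, Rmin a b <= u <= Rmax a b -> is_series (fun n => f n u) (g u)) ->
  (forall n, is_RInt (f n) a b (I n)) -> is_series I l ->
  is_RInt g a b l.
Proof.
intros HM HMs Hg HI Hl.
set (cl := fun u => Rmax (Rmin a b) (Rmin u (Rmax a b))).
assert (Hcl : forall u, Rmin a b <= cl u <= Rmax a b).
{ intros u; unfold cl.
  pose proof (Rmin_Rmax a b).
  split; [apply Rmax_l | apply Rmax_lub; [lra | apply Rmin_r]]. }
assert (Hid : forall u, Rmin a b < u < Rmax a b -> cl u = u).
{ intros u Hu; unfold cl; rewrite (Rmin_left u), Rmax_right; lra. }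
destruct (filterlim_RInt (fun N u => sum_n (fun n => f n (cl u)) N) a b eventually
  _ (fun u => g (cl u)) (sum_n I)) as [l' [Hl' Hint]].
- intros N; apply is_RInt_ext with (fun u => sum_n (fun n => f n u) N).
  { intros u Hu; rewrite Hid by auto; reflexivity. }
  exact (is_RInt_sum_n f I a b N HI).
- apply (weierstrass_test (fun n u => f n (cl u)) M); auto.
- rewrite (filterlim_locally_unique (F := eventually) (sum_n I) l l' Hl Hl').
  apply is_RInt_ext with (2 := Hint).
  intros u Hu; rewrite Hid by auto; reflexivity.
Qed.

(** * Half-derivative of a series of exponentials *)

Definition half_kernel (n : nat) (u : R) : R :=
  (exp (- (INR n * u)) - 1) / Rpower u (3 / 2).

Definition half_kernel_prim (n : nat) (u : R) : R :=
  sqrt (INR n) * half_prim (INR n * u).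

Lemma INR_0_or_ge_1 (n : nat) : n = O \/ 1 <= INR n.
Proof.
destruct n as [|n]; auto; right.
rewrite S_INR; pose proof (pos_INR n); lra.
Qed.

Lemma half_kernel_0 (u : R) : half_kernel 0 u = 0.
Proof.
unfold half_kernel; simpl; rewrite Rmult_0_l, Ropp_0, exp_0; unfold Rdiv; ring.
Qed.

Lemma is_derive_half_kernel_prim (n : nat) (u : R) :
  0 < u -> is_derive (half_kernel_prim n) u (- half_kernel n u).
Proof.
intros Hu; destruct (INR_0_or_ge_1 n) as [->|Hn].
- rewrite half_kernel_0, Ropp_0.
  apply is_derive_ext with (fun _ => 0).
  { intros t; unfold half_kernel_prim; simpl; rewrite sqrt_0; ring. }
  apply (is_derive_const (V := R_NormedModule)).
- unfold half_kernel_prim.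
  assert (Hnu : 0 < INR n * u) by nra.
  evar_last.
  { apply (is_derive_scal (fun u => half_prim (INR n * u))).
    apply (is_derive_comp (V := R_NormedModule) half_prim (fun u => INR n * u)).
    - apply is_derive_half_prim, Hnu.
    - apply (is_derive_scal (fun u => u)), (is_derive_id u). }
  unfold half_kernel; rewrite !Rpower_three_halves, sqrt_mult by lra.
  assert (Hs := sqrt_lt_R0 u Hu).
  assert (Hsn : 0 < sqrt (INR n)) by (apply sqrt_lt_R0; lra).
  unfold scal, one; simpl; unfold mult; simpl.
  field; repeat split; lra.
Qed.

Lemma continuous_half_kernel (n : nat) (u : R) :
  0 < u -> continuous (half_kernel n) u.
Proof.
intros Hu; apply (ex_derive_continuous (V := R_NormedModule)).
unfold half_kernel, Rpower; auto_derive.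
pose proof (exp_pos (3 / 2 * ln u)); repeat split; auto; lra.
Qed.

(** The factor [sqrt (INR n)] stands for the bound [1] of the numerator when
    [n] is positive and for its vanishing when [n] is zero, so that
    the summability of [sqrt n * norm (c n)] alone is enough. *)
Lemma half_kernel_bound (n : nat) (m u : R) :
  0 < m <= u -> Rabs (half_kernel n u) <= sqrt (INR n) * / Rpower m (3 / 2).
Proof.
intros Hu; destruct (INR_0_or_ge_1 n) as [->|Hn].
- rewrite half_kernel_0, Rabs_R0; simpl; rewrite sqrt_0; lra.
- unfold half_kernel.
  assert (B := one_minus_exp_bounds (INR n * u) ltac:(nra)).
  unfold Rdiv; rewrite Rabs_mult.
  assert (Hp : forall y, 0 < Rpower y (3 / 2)) by (intros; apply exp_pos).
  rewrite (Rabs_pos_eq (/ _)) by (left; apply Rinv_0_lt_compat, Hp).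
  apply Rmult_le_compat; try apply Rabs_pos.
  + left; apply Rinv_0_lt_compat, Hp.
  + apply Rle_trans with 1; [apply Rabs_le; lra|].
    rewrite <- sqrt_1; apply sqrt_le_1; lra.
  + apply Rinv_le_contravar; [apply Hp|].
    apply Rle_Rpower_l; lra.
Qed.

Lemma half_kernel_prim_bound (n : nat) (u : R) :
  Rabs (half_kernel_prim n u) <= 6 * sqrt (INR n).
Proof.
unfold half_kernel_prim; rewrite Rabs_mult, (Rabs_pos_eq (sqrt _)) by apply sqrt_pos.
rewrite Rmult_comm; apply Rmult_le_compat_r; [apply sqrt_pos|].
destruct (Rle_or_lt (INR n * u) 0) as [H|H].
- rewrite half_prim_npos, Rabs_R0; lra.
- apply half_prim_bounds, H.
Qed.

Lemma half_kernel_prim_lim0 (n : nat) :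
  filterlim (half_kernel_prim n) (at_right 0) (locally 0).
Proof.
destruct (INR_0_or_ge_1 n) as [->|Hn].
- apply filterlim_ext with (fun _ => 0); [|apply filterlim_const].
  intros t; unfold half_kernel_prim; simpl; rewrite sqrt_0; ring.
- replace 0 with (sqrt (INR n) * 0) at 2 by ring.
  apply (filterlim_comp _ _ _ (fun u => half_prim (INR n * u)) (Rmult (sqrt (INR n)))
    _ (locally 0)).
  2: exact (filterlim_Rbar_mult_l (sqrt (INR n)) (Finite 0)).
  apply (filterlim_comp _ _ _ (Rmult (INR n)) half_prim _ (at_right 0)).
  2: exact half_prim_lim0.
  intros P HP; unfold filtermap, at_right, within in *.
  assert (L := filterlim_Rbar_mult_l (INR n) (Finite 0)).
  simpl in L; rewrite Rmult_0_r in L.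
  generalize (L _ HP); unfold filtermap; apply filter_imp.
  intros u Hu Hpos; apply Hu; nra.
Qed.

Lemma half_kernel_prim_lim (n : nat) :
  filterlim (half_kernel_prim n) (Rbar_locally p_infty)
    (locally (2 * sqrt PI * sqrt (INR n))).
Proof.
destruct (INR_0_or_ge_1 n) as [->|Hn].
- simpl INR; rewrite sqrt_0, Rmult_0_r.
  apply filterlim_ext with (fun _ => 0); [|apply filterlim_const].
  intros t; unfold half_kernel_prim; simpl; rewrite sqrt_0; ring.
- rewrite Rmult_comm.
  apply (filterlim_comp _ _ _ (fun u => half_prim (INR n * u)) (Rmult (sqrt (INR n)))
    _ (locally (2 * sqrt PI))).
  2: exact (filterlim_Rbar_mult_l (sqrt (INR n)) (Finite (2 * sqrt PI))).
  apply (filterlim_comp _ _ _ (Rmult (INR n)) half_prim _ (Rbar_locally p_infty)).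
  2: exact half_prim_lim.
  assert (L := filterlim_Rbar_mult_l (INR n) p_infty).
  replace (Rbar_mult (INR n) p_infty) with p_infty in L; [exact L|].
  symmetry; apply is_Rbar_mult_unique, is_Rbar_mult_sym, is_Rbar_mult_p_infty_pos.
  simpl; lra.
Qed.

Lemma is_series_iota {K : AbsRing} {V : CompleteNormedModule K} (a : nat -> V) :
  ex_series a -> is_series a (iota (fun l : V => is_series a l)).
Proof.
intros [l Hl].
exact (eq_ind_r (fun s : V => is_series a s) Hl
         (iota_filterlim_locally (V := V) (sum_n a) l Hl)).
Qed.

(** The difference of the values of the dominated series [P] of primitives is
    the integral over any segment of positive numbers; the improper integral is then
    read off from the limits of [P] at [0+] and at infinity. *)
Theorem half_derivative_exp_series {V : CompleteNormedModule R_AbsRing}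
  (c : nat -> V) (g : R -> V) :
  ex_series (fun n => sqrt (INR n) * norm (c n)) ->
  (forall u, 0 < u -> is_series (fun n => scal (half_kernel n u) (c n)) (g u)) ->
  exists l, is_series (fun n => scal (sqrt (INR n)) (c n)) l /\
    is_RInt_gen g (at_right 0) (Rbar_locally p_infty) (scal (- (2 * sqrt PI)) l).
Proof.
intros Hc Hg.
set (p n u := scal (half_kernel_prim n u) (c n)).
assert (Hp : forall n u, norm (p n u) <= scal 6 (sqrt (INR n) * norm (c n))).
{ intros n u; apply Rle_trans with (1 := norm_scal (V := V) (half_kernel_prim n u : R_AbsRing) (c n)).
  unfold scal; simpl; unfold mult; simpl; rewrite <- Rmult_assoc.
  apply Rmult_le_compat_r; [apply norm_ge_0 | apply half_kernel_prim_bound]. }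
assert (HMs : ex_series (fun n => scal 6 (sqrt (INR n) * norm (c n)))).
{ exact (ex_series_scal 6 _ Hc). }
assert (HP : forall u, is_series (fun n => p n u)
  (iota (fun l : V => is_series (fun n => p n u) l))).
{ intros u; apply is_series_iota.
  exact (ex_series_le (fun n => p n u) _ (fun n => Hp n u) HMs). }
set (P u := iota (fun l : V => is_series (fun n => p n u) l)) in HP.
destruct (tannery p _ P (at_right 0) _ (fun n => scal 0 (c n)) Hp HMs HP) as [l0 [S0 L0]].
{ intros n; apply (filterlim_comp _ _ _ (half_kernel_prim n) (fun k : R => scal k (c n))
    _ _ _ (half_kernel_prim_lim0 n) (filterlim_scal_l (0:R) (c n))). }
destruct (tannery p _ P (Rbar_locally p_infty) _
  (fun n => scal (2 * sqrt PI * sqrt (INR n)) (c n)) Hp HMs HP) as [l1 [S1 L1]].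
{ intros n; apply (filterlim_comp _ _ _ (half_kernel_prim n) (fun k : R => scal k (c n))
    _ _ _ (half_kernel_prim_lim n) (filterlim_scal_l _ (c n))). }
assert (Hl : exists l, is_series (fun n => scal (sqrt (INR n)) (c n)) l).
{ apply ex_series_le with (2 := Hc); intros n.
  apply Rle_trans with (1 := norm_scal (V := V) (sqrt (INR n) : R_AbsRing) (c n)); right; f_equal.
  apply Rabs_pos_eq, sqrt_pos. }
destruct Hl as [l Hl]; exists l; split; auto.
(* The two limits of [P] are multiples of the sum [l] of the target series. *)
assert (E0 : l0 = zero).
{ refine (eq_trans _ (scal_zero_l (V := V) l)).
  apply (filterlim_locally_unique (F := eventually) _ _ _ S0).
  apply is_series_ext with (2 := is_series_scal (zero : R_AbsRing) _ _ Hl).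
  intros n; rewrite scal_assoc; f_equal; exact (Rmult_0_l _). }
assert (E1 : l1 = scal (2 * sqrt PI) l).
{ apply (filterlim_locally_unique (F := eventually) _ _ _ S1).
  apply is_series_ext with (2 := is_series_scal (2 * sqrt PI) _ _ Hl).
  intros n; rewrite scal_assoc; reflexivity. }
assert (HI : forall a b, 0 < a -> 0 < b -> is_RInt g a b (minus (P a) (P b))).
{ intros a b Ha Hb.
  assert (Hm : 0 < Rmin a b) by (apply Rmin_glb_lt; auto).
  apply (is_RInt_series (fun n u => scal (half_kernel n u) (c n))
    (fun n => scal (/ Rpower (Rmin a b) (3 / 2)) (sqrt (INR n) * norm (c n)))
    g (fun n => minus (p n a) (p n b))).
  - intros n u Hu; apply Rle_trans with (1 := norm_scal (V := V) (half_kernel n u : R_AbsRing) (c n)).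
    unfold scal; simpl; unfold mult; simpl; rewrite <- Rmult_assoc.
    apply Rmult_le_compat_r; [apply norm_ge_0|].
    rewrite (Rmult_comm (/ _)); apply half_kernel_bound; lra.
  - exact (ex_series_scal _ _ Hc).
  - intros u Hu; apply Hg; lra.
  - intros n.
    replace (minus (p n a) (p n b)) with
      (minus (scal (- half_kernel_prim n b) (c n)) (scal (- half_kernel_prim n a) (c n))).
    2: { unfold p, minus; rewrite <- !scal_opp_l.
         unfold opp; simpl; rewrite Ropp_involutive; apply plus_comm. }
    apply (is_RInt_derive (fun u => scal (- half_kernel_prim n u) (c n))).
    + intros u Hu.
      refine (is_derive_scal_l (K := R_AbsRing) (V := V)
        (fun u => - half_kernel_prim n u) u (half_kernel n u) (c n) _).
      rewrite <- (Ropp_involutive (half_kernel n u)).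
      apply (is_derive_opp (V := R_NormedModule) (half_kernel_prim n)).
      apply is_derive_half_kernel_prim; lra.
    + intros u Hu.
      apply (continuous_comp (half_kernel n) (fun k : R => scal k (c n))).
      * apply continuous_half_kernel; lra.
      * exact (filterlim_scal_l (half_kernel n u : R) (c n)).
  - apply (is_series_minus (fun n => p n a) (fun n => p n b)); apply HP. }
intros Q HQ.
replace (scal (- (2 * sqrt PI)) l) with (minus l0 l1) in HQ.
2: { rewrite E0, E1; unfold minus.
     rewrite plus_zero_l; symmetry; exact (scal_opp_l (V := V) (2 * sqrt PI : R_AbsRing) l). }
assert (LL : filterlim (fun ab => minus (P (fst ab)) (P (snd ab)))
  (filter_prod (at_right 0) (Rbar_locally p_infty)) (locally (minus l0 l1))).
{ apply (filterlim_comp_2 (fun ab : R * R => P (fst ab))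
           (fun ab => opp (P (snd ab))) plus (G := locally l0) (H := locally (opp l1))).
  - apply filterlim_comp with (2 := L0); apply filterlim_fst.
  - apply (filterlim_comp _ _ _ (fun ab : R * R => P (snd ab)) opp _ (locally l1)).
    + apply filterlim_comp with (2 := L1); apply filterlim_snd.
    + exact (filterlim_opp (V := V) l1).
  - exact (filterlim_plus (V := V) l0 (opp l1)). }
assert (Hpos : filter_prod (at_right 0) (Rbar_locally p_infty)
  (fun ab => 0 < fst ab /\ 0 < snd ab)).
{ exists (fun a => 0 < a) (fun b => 0 < b); auto.
  - exists (mkposreal 1 Rlt_0_1); auto.
  - exists 0; auto. }
refine (filter_imp
  (fun ab => (0 < fst ab /\ 0 < snd ab) /\ Q (minus (P (fst ab)) (P (snd ab)))) _ _
  (filter_and (fun ab => 0 < fst ab /\ 0 < snd ab)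
     (fun ab => Q (minus (P (fst ab)) (P (snd ab)))) Hpos (LL Q HQ))).
intros [a b] [[Ha Hb] H]; exists (minus (P a) (P b)); split; auto.
Qed.

(** * The series with coefficients [x ^ n / n!^2] *)

Definition coef (x : C) (n : nat) : C :=
  (x ^ n / (RtoC (INR (fact n)) * RtoC (INR (fact n))))%C.

Lemma fact_pos (n : nat) : 1 <= INR (fact n).
Proof. apply (le_INR 1), lt_O_fact. Qed.

Lemma RtoC_fact_neq0 (n : nat) : RtoC (INR (fact n)) <> 0%C.
Proof. intros H; apply (INR_fact_neq_0 n), RtoC_inj, H. Qed.

Lemma le_fact (n : nat) : INR n <= INR (fact n).
Proof.
apply le_INR; destruct n as [|n]; [apply Nat.le_0_l|].
simpl; pose proof (lt_O_fact n); nia.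
Qed.

Lemma sqrt_le_fact (n : nat) : sqrt (INR n) <= INR (fact n).
Proof.
apply Rle_trans with (2 := le_fact n); destruct (INR_0_or_ge_1 n) as [->|Hn].
- simpl; rewrite sqrt_0; lra.
- rewrite <- (sqrt_sqrt (INR n)) at 2 by lra.
  assert (H : 1 <= sqrt (INR n)) by (rewrite <- sqrt_1; apply sqrt_le_1; lra).
  nra.
Qed.

(** The norm meant here is the one of [C] as a real vector space. *)
Lemma norm_coef (x : C) (n : nat) :
  norm (coef x n : C_R_NormedModule) =
  Cmod x ^ n / (INR (fact n) * INR (fact n)).
Proof.
change (norm (coef x n : C_R_NormedModule)) with
  (@norm R_AbsRing (prod_NormedModule R_AbsRing R_NormedModule R_NormedModule)
    (coef x n)).
rewrite <- Cmod_norm; unfold coef; pose proof (fact_pos n).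
rewrite <- RtoC_mult, Cmod_div, Cmod_pow, Cmod_R.
- rewrite Rabs_pos_eq; nra.
- intros E; apply RtoC_inj in E; nra.
Qed.

Lemma ex_series_exp (r : R) : ex_series (fun n => r ^ n / INR (fact n)).
Proof.
exists (exp r); apply is_series_ext with (2 := is_exp_Reals r).
intros n; rewrite pow_n_pow; reflexivity.
Qed.

(** One of the two factorials absorbs [sqrt n]; the other one leaves the
    exponential series of [Cmod x]. *)
Lemma ex_series_coef (x : C) :
  ex_series (fun n => sqrt (INR n) * norm (coef x n : C_R_NormedModule)).
Proof.
apply (ex_series_le (V := R_CompleteNormedModule)) with (2 := ex_series_exp (Cmod x)).
intros n; rewrite norm_coef.
assert (Hf := fact_pos n); assert (Hs := sqrt_le_fact n).
assert (Hp : 0 <= Cmod x ^ n / INR (fact n)).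
{ apply Rdiv_le_0_compat; [apply pow_le, Cmod_ge_0 | lra]. }
replace (sqrt (INR n) * (Cmod x ^ n / (INR (fact n) * INR (fact n)))) with
  (sqrt (INR n) * / INR (fact n) * (Cmod x ^ n / INR (fact n))) by (field; lra).
change (Rabs (sqrt (INR n) * / INR (fact n) * (Cmod x ^ n / INR (fact n))) <=
  Cmod x ^ n / INR (fact n)).
assert (Hq : 0 <= sqrt (INR n) * / INR (fact n) <= 1).
{ split.
  - apply Rdiv_le_0_compat; [apply sqrt_pos | lra].
  - apply (Rle_div_l (sqrt (INR n))); lra. }
rewrite Rabs_pos_eq; nra.
Qed.

Lemma f_term_scal (x : C) (t : R) (n : nat) :
  f_term x t n = scal (exp (- (INR n * t))) (coef x n : C_R_NormedModule).
Proof.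
rewrite scal_R_Cmult; unfold f_term, coef.
replace (RtoC (exp (- t)) ^ n)%C with (RtoC (exp (- (INR n * t)))).
2: { rewrite <- RtoC_pow, <- Rpower_pow by apply exp_pos.
     unfold Rpower; rewrite ln_exp; do 2 f_equal; ring. }
field; apply RtoC_fact_neq0.
Qed.

Lemma sqrt_term_scal (x : C) (n : nat) :
  sqrt_term x n = scal (sqrt (INR n)) (coef x n : C_R_NormedModule).
Proof.
rewrite scal_R_Cmult; unfold sqrt_term, coef; field; apply RtoC_fact_neq0.
Qed.

Lemma ex_series_f (x : C) (t : R) : ex_series (V := C_R_NormedModule) (f_term x t).
Proof.
apply (ex_series_le (V := C_R_CompleteNormedModule)) with
  (2 := ex_series_exp (Cmod x * exp (- t))).
intros n.
change (@norm R_AbsRing (prod_NormedModule R_AbsRing R_NormedModule R_NormedModule)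
  (f_term x t n) <= (Cmod x * exp (- t)) ^ n / INR (fact n)).
rewrite <- Cmod_norm; unfold f_term; pose proof (fact_pos n).
rewrite <- RtoC_mult, Cmod_div, Cmod_mult, !Cmod_pow, !Cmod_R.
- rewrite (Rabs_pos_eq (exp _)) by (left; apply exp_pos).
  rewrite Rabs_pos_eq by nra; rewrite <- Rpow_mult_distr.
  apply Rmult_le_compat_l.
  + apply pow_le, Rmult_le_pos; [apply Cmod_ge_0 | left; apply exp_pos].
  + apply Rinv_le_contravar; nra.
- intros E; apply RtoC_inj in E; nra.
Qed.

Lemma is_series_integrand (x : C) (u : R) : 0 < u ->
  is_series (V := C_R_NormedModule)
    (fun n => scal (half_kernel n u) (coef x n : C_R_NormedModule)) (integrand x u).
Proof.
intros Hu; set (k := / Rpower u (3 / 2)).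
assert (Hk : 0 < Rpower u (3 / 2)) by apply exp_pos.
replace (integrand x u) with
  (scal k (minus (f_fun x u : C_R_NormedModule) (f_fun x 0))).
2: { unfold integrand; rewrite scal_R_Cmult; unfold k.
     rewrite RtoC_inv by lra.
     change (minus (f_fun x u : C_R_NormedModule) (f_fun x 0)) with
       (f_fun x u - f_fun x 0)%C.
     apply Cmult_comm. }
apply is_series_ext with
  (fun n => scal k (minus (f_term x u n : C_R_NormedModule) (f_term x 0 n))).
- intros n; rewrite !f_term_scal; unfold minus.
  rewrite <- (scal_opp_l (V := C_R_NormedModule)).
  rewrite <- (scal_distr_r (V := C_R_NormedModule)), scal_assoc.
  f_equal; unfold half_kernel, k, plus, opp, mult; simpl.
  rewrite Rmult_0_r, Ropp_0, exp_0; field; lra.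
- apply (is_series_scal (V := C_R_NormedModule)).
  apply (is_series_minus (V := C_R_NormedModule));
    exact (CSeries_correct _ (ex_series_f x _)).
Qed.

Lemma cancel_sqrt_PI (l : C) :
  l = (- (1 / (RtoC 2 * RtoC (sqrt PI))) * (RtoC (- (2 * sqrt PI)) * l))%C.
Proof.
rewrite RtoC_opp, RtoC_mult; field; intros E; apply RtoC_inj in E.
pose proof (sqrt_lt_R0 PI PI_RGT_0); lra.
Qed.

Theorem theorem22 (x : C) :
  (forall t : R, ex_series (V := C_NormedModule) (f_term x t)) /\
  ex_series (V := C_NormedModule) (sqrt_term x) /\
  ex_RInt_gen (V := C_R_NormedModule) (integrand x)
    (at_right 0) (Rbar_locally p_infty) /\
  CSeries (sqrt_term x) =
    (- (1 / (RtoC 2 * RtoC (sqrt PI))) *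
       RInt_gen (V := C_R_CompleteNormedModule) (integrand x)
         (at_right 0) (Rbar_locally p_infty))%C.
Proof.
destruct (half_derivative_exp_series (V := C_R_CompleteNormedModule) (coef x)
  (integrand x) (ex_series_coef x) (is_series_integrand x)) as [l [Hl Hint]].
assert (Hs : is_series (V := C_NormedModule) (sqrt_term x) l).
{ apply is_series_ext with (2 := Hl); intros n.
  symmetry; exact (sqrt_term_scal x n). }
split; [exact (ex_series_f x)|].
split; [exists l; exact Hs|].
split; [eexists; exact Hint|].
rewrite (CSeries_unique _ _ Hs).
rewrite (is_RInt_gen_unique (V := C_R_CompleteNormedModule) _ _ Hint).
refine (eq_trans _ (f_equal (Cmult _) (eq_sym (scal_R_Cmult _ _)))).
apply cancel_sqrt_PI.
Qed.
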